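(* For every integer $n\ge 1$ the following equalities hold: \begin{align*} 2^{n-1}&=1+\sum_{s=1}^{\lfloor\frac{n}{2}\rfloor}\sum_{m=0}^{n-2s} \binom{n-s-m}{s}\binom{m+s-1}{m}=1+\sum_{s=1}^{\lfloor\frac{n}{2}\rfloor}\binom{n}{2s},\\ 2^{n-1}&=\sum_{s=0}^{\lfloor\frac{n-1}{2}\rfloor}\sum_{m=0}^{n-2s-1} \binom{n-s-m-1}{s}\binom{m+s}{m}=\sum_{s=0}^{\lfloor\frac{n-1}{2}\rfloor}\binom{n}{2s+1},\\ 2^{n-1}&=1+\sum_{s=1}^{\lfloor\frac{n}{2}\rfloor}\sum_{m=0}^{n-2s} \binom{n-s-m-1}{s-1}\binom{m+s}{m}=1+\sum_{s=1}^{\lfloor\frac{n}{2}\rfloor}\binom{n}{2s}. \end{align*}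
   Context: $\lfloor x\rfloor$ is the floor function; empty sums are $0$. *)

(* Defs.v *)
From mathcomp Require Export all_boot.

(* Main.v *)
Require Import Defs.
From mathcomp Require Import all_boot.
From mathcomp Require Import zify.

(** Every inner sum runs over the antidiagonal [i + m = k] and is a coefficient
    of a product of two power series: since [(1 - x) ^ -(b + 1)] has
    coefficients ['C(b + m, m)], the identity
    [(1 - x) ^ -(a + 1) * (1 - x) ^ -(b + 1) = (1 - x) ^ -(a + b + 2)] gives the
    convolution [sum_bin_convolution].  The three lines take [(a, b)] to be
    [(s, s - 1)], [(s, s)] and [(s - 1, s)], so the inner sums become
    ['C(n, 2 * s)], ['C(n, 2 * s + 1)] and ['C(n, 2 * s)].

    What remains is that the even-indexed and the odd-indexed entries of row
    [n] of the Pascal triangle each sum to [2 ^ (n - 1)].  Pascal's rule splits an entry of row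
    [n] into two neighbours of row [n - 1]; as the index runs over one parity
    class, these pairs tile row [n - 1], whose sum is [2 ^ (n - 1)]
    ([sum_bin_even_row], [sum_bin_odd_row]). *)

(** The case [b = 0] of the convolution below (hockey-stick identity). *)
Lemma sum_bin_diag (a k : nat) :
  \sum_(0 <= m < k.+1) 'C(a + (k - m), a) = 'C((a + k).+1, k).
Proof.
elim: k => [|k IHk]; first by rewrite big_nat1 addn0 binn bin0.
rewrite big_nat_recl // subn0 (eq_bigr (fun m => 'C(a + (k - m), a))) //.
rewrite IHk binS addnS; congr addn.
by rewrite -bin_sub ?leqW ?leq_addr // -addnS addKn.
Qed.

(** By Pascal's rule (on the left, for the second factor) both sides satisfy
    [f b.+1 k.+1 = f b k.+1 + f b.+1 k], so they agree once they agree for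
    [b = 0] and for [k = 0]. *)
Lemma sum_bin_convolution (a b k : nat) :
  \sum_(0 <= m < k.+1) 'C(a + (k - m), a) * 'C(b + m, m) =
  'C((a + b + k).+1, k).
Proof.
elim: b k => [|b IHb] k.
  rewrite addn0 -sum_bin_diag; apply: eq_bigr => m _.
  by rewrite add0n binn muln1.
elim: k => [|k IHk]; first by rewrite big_nat1 subnn !addn0 binn !bin0.
transitivity (\sum_(0 <= m < k.+2) 'C(a + (k.+1 - m), a) * 'C(b + m, m) +
              \sum_(0 <= m < k.+1) 'C(a + (k - m), a) * 'C(b.+1 + m, m)).
  rewrite big_nat_recl // [X in _ = X + _]big_nat_recl // !bin0 -addnA.
  rewrite -big_split; congr addn; apply: eq_bigr => m _ /=.
  by rewrite subSS -mulnDr addSn binS addnS addSn.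
by rewrite IHb IHk [RHS]binS !addnS !addSn.
Qed.

Lemma sum_bin_row (p k : nat) : p < k -> \sum_(0 <= j < k) 'C(p, j) = 2 ^ p.
Proof.
move=> ltpk; rewrite (big_cat_nat (n := p.+1)) //= [X in _ + X]big_nat_cond.
rewrite [X in _ + X]big1 => [|j /andP[/andP[ltpj _] _]]; last exact: bin_small.
rewrite addn0 big_mkord -[2]/(1 + 1) expnDn.
by apply: eq_bigr => j _; rewrite !exp1n !muln1.
Qed.

(** The pairs from Pascal's rule start at [j = 1], so the term [1] on the left
    supplies the missing entry ['C(p, 0)].  The upper bound [k] is free because
    this allows induction on it; the right side is the whole row once
    [p <= 2 * k]. *)
Lemma sum_bin_even_row (p k : nat) :
  1 + \sum_(1 <= s < k.+1) 'C(p.+1, 2 * s) = \sum_(0 <= j < (2 * k).+1) 'C(p, j).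
Proof.
elim: k => [|k IHk]; first by rewrite big_geq // big_nat1 bin0.
rewrite big_nat_recr //= addnA IHk mulnS binS [RHS]big_nat_recr //=.
by rewrite [in RHS]big_nat_recr //= -addnA [X in _ + X]addnC.
Qed.

(** Here the pairs are [j = 2 * s] and [j = 2 * s + 1], and they tile the row
    from its first entry. *)
Lemma sum_bin_odd_row (p k : nat) :
  \sum_(0 <= s < k) 'C(p.+1, 2 * s + 1) = \sum_(0 <= j < 2 * k) 'C(p, j).
Proof.
elim: k => [|k IHk]; first by rewrite !big_geq.
rewrite big_nat_recr //= IHk mulnS addn1 binS [RHS]big_nat_recr //=.
by rewrite [in RHS]big_nat_recr //= -addnA [X in _ + X]addnC.
Qed.

(* Every subtraction below is exact on the stated ranges, so the truncated
   subtraction of nat agrees with that of the integers. *)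
Theorem proposition4p1 (n : nat) (hn : 1 <= n) :
  (2 ^ (n - 1) =
     1 + \sum_(1 <= s < (n %/ 2).+1) \sum_(0 <= m < (n - 2 * s).+1)
           'C(n - s - m, s) * 'C(m + s - 1, m)
   /\
   1 + \sum_(1 <= s < (n %/ 2).+1) \sum_(0 <= m < (n - 2 * s).+1)
         'C(n - s - m, s) * 'C(m + s - 1, m) =
     1 + \sum_(1 <= s < (n %/ 2).+1) 'C(n, 2 * s))
  /\
  (2 ^ (n - 1) =
     \sum_(0 <= s < ((n - 1) %/ 2).+1) \sum_(0 <= m < (n - 2 * s - 1).+1)
       'C(n - s - m - 1, s) * 'C(m + s, m)
   /\
   \sum_(0 <= s < ((n - 1) %/ 2).+1) \sum_(0 <= m < (n - 2 * s - 1).+1)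
     'C(n - s - m - 1, s) * 'C(m + s, m) =
     \sum_(0 <= s < ((n - 1) %/ 2).+1) 'C(n, 2 * s + 1))
  /\
  (2 ^ (n - 1) =
     1 + \sum_(1 <= s < (n %/ 2).+1) \sum_(0 <= m < (n - 2 * s).+1)
           'C(n - s - m - 1, s - 1) * 'C(m + s, m)
   /\
   1 + \sum_(1 <= s < (n %/ 2).+1) \sum_(0 <= m < (n - 2 * s).+1)
         'C(n - s - m - 1, s - 1) * 'C(m + s, m) =
     1 + \sum_(1 <= s < (n %/ 2).+1) 'C(n, 2 * s)).
Proof.
have even_sum : 1 + \sum_(1 <= s < (n %/ 2).+1) 'C(n, 2 * s) = 2 ^ (n - 1).
  case: n hn => // p _; rewrite sum_bin_even_row subn1 sum_bin_row //=.
  by lia.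
have odd_sum :
    \sum_(0 <= s < ((n - 1) %/ 2).+1) 'C(n, 2 * s + 1) = 2 ^ (n - 1).
  case: n hn {even_sum} => // p _; rewrite sum_bin_odd_row subn1 sum_bin_row //=.
  by lia.
have first_sum : 1 + \sum_(1 <= s < (n %/ 2).+1)
      \sum_(0 <= m < (n - 2 * s).+1) 'C(n - s - m, s) * 'C(m + s - 1, m) =
    1 + \sum_(1 <= s < (n %/ 2).+1) 'C(n, 2 * s).
  congr (1 + _); apply: eq_big_nat => s /andP[s_gt0 le_s].
  rewrite -bin_sub; last by lia.
  have -> : 'C(n, n - 2 * s) = 'C((s + (s - 1) + (n - 2 * s)).+1, n - 2 * s).
    by congr 'C(_, _); lia.
  rewrite -sum_bin_convolution; apply: eq_big_nat => m /andP[_ le_m].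
  by congr ('C(_, _) * 'C(_, _)); lia.
have second_sum : \sum_(0 <= s < ((n - 1) %/ 2).+1)
      \sum_(0 <= m < (n - 2 * s - 1).+1) 'C(n - s - m - 1, s) * 'C(m + s, m) =
    \sum_(0 <= s < ((n - 1) %/ 2).+1) 'C(n, 2 * s + 1).
  apply: eq_big_nat => s /andP[_ le_s].
  rewrite -bin_sub; last by lia.
  have -> : 'C(n, n - (2 * s + 1)) =
            'C((s + s + (n - 2 * s - 1)).+1, n - 2 * s - 1).
    by congr 'C(_, _); lia.
  rewrite -sum_bin_convolution; apply: eq_big_nat => m /andP[_ le_m].
  by congr ('C(_, _) * 'C(_, _)); lia.
have third_sum : 1 + \sum_(1 <= s < (n %/ 2).+1)
      \sum_(0 <= m < (n - 2 * s).+1) 'C(n - s - m - 1, s - 1) * 'C(m + s, m) =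
    1 + \sum_(1 <= s < (n %/ 2).+1) 'C(n, 2 * s).
  congr (1 + _); apply: eq_big_nat => s /andP[s_gt0 le_s].
  rewrite -bin_sub; last by lia.
  have -> : 'C(n, n - 2 * s) = 'C((s - 1 + s + (n - 2 * s)).+1, n - 2 * s).
    by congr 'C(_, _); lia.
  rewrite -sum_bin_convolution; apply: eq_big_nat => m /andP[_ le_m].
  by congr ('C(_, _) * 'C(_, _)); lia.
by rewrite first_sum second_sum third_sum even_sum odd_sum.
Qed.
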